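(* Let $d\ge1$ be an integer and let $\mu,\nu\in\mathcal{P}_2(\mathbb{R}^d)$ share the same barycentre, i.e. $[\mu]=[\nu]$. Then $$Z_2(\mu,\nu)\ \le\ \sqrt{\frac{\mathrm{var}(\mu)+\mathrm{var}(\nu)}{2}}\ W_2(\mu,\nu),$$ and this inequality is an equality if and only if $\mu=\nu$.
   Context: $\mathcal{P}_2(\mathbb{R}^d)$ is the set of Borel probability measures $\mu$ on $\mathbb{R}^d$ with $\int|x|^2\,\mu(dx)<+\infty$, where $|\cdot|$ is the Euclidean norm. $[\mu]=\int x\,\mu(dx)$ is the barycentre and $\mathrm{var}(\mu)=\int|x-[\mu]|^2\,\mu(dx)$ the variance. $\Gamma(\mu,\nu)$ is the set of Borel probability measures on $\mathbb{R}^d\times\mathbb{R}^d$ with first marginal $\mu$ and second marginal $\nu$. The Wasserstein distance is $$W_2(\mu,\nu)=\Big(\inf\Big\{\iint|x-y|^2\,\gamma(dxdy)\,:\,\gamma\in\Gamma(\mu,\nu)\Big\}\Big)^{1/2}.$$ $C^{1,1}(\mathbb{R}^d)$ is the space of continuously differentiable functions $u:\mathbb{R}^d\to\mathbb{R}$ whose gradient is Lipschitz, and $\mathrm{lip}(\nabla u)$ denotes the (Euclidean) Lipschitz constant of $\nabla u$. The second-order Zolotarev distance between measures with $[\mu]=[\nu]$ is $$Z_2(\mu,\nu)=\sup\Big\{\int u\,d(\nu-\mu)\,:\,u\in C^{1,1}(\mathbb{R}^d),\ \mathrm{lip}(\nabla u)\le1\Big\}.$$ *)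

(* Defs.v *)
From HB Require Import structures.
From mathcomp Require Import all_boot all_order all_algebra.
From mathcomp Require Import all_classical all_reals all_analysis.
Set Implicit Arguments.
Unset Strict Implicit.
Unset Printing Implicit Defensive.
Import Order.TTheory GRing.Theory Num.Theory.
Import numFieldNormedType.Exports.
Local Open Scope classical_set_scope.
Local Open Scope ring_scope.

(* R^d is 'rV[R]_d, which the library equips with a topology but with no
   measurable structure; we use the Borel sigma-algebra.  By second
   countability, the library's product sigma-algebra on 'rV[R]_d * 'rV[R]_d
   is then the Borel one too. *)
Section borel_rV.
Variables (R : realType) (d : nat).
Let opens : set (set 'rV[R]_d) := open.

HB.instance Definition _ :=
  @isMeasurable.Build (sigma_display opens) 'rV[R]_d <<s opens >>
    (@sigma_algebra0 _ setT opens) (@sigma_algebraC _ opens)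
    (@sigma_algebra_bigcup _ setT opens).

End borel_rV.

Section definitions.
Variables (R : realType) (d : nat).
Implicit Types (mu nu : probability 'rV[R]_d R) (x y : 'rV[R]_d).

(* The library norm `|x| on 'rV[R]_d is the sup norm; it induces the same
   topology and the same notion of differentiability. *)
Definition enorm x : R := Num.sqrt (\sum_(i < d) x 0 i ^+ 2).

Definition P2 mu : Prop := (\int[mu]_x (enorm x ^+ 2)%:E < +oo)%E.

Definition barycentre mu : 'rV[R]_d := \row_i \int[mu]_x x 0 i.

Definition var mu : \bar R :=
  (\int[mu]_x (enorm (x - barycentre mu) ^+ 2)%:E)%E.

Definition couplings mu nu : set (probability ('rV[R]_d * 'rV[R]_d)%type R) :=
  [set gamma | forall A : set 'rV[R]_d, measurable A ->
     pushforward gamma fst A = mu A /\ pushforward gamma snd A = nu A].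

Definition W2 mu nu : \bar R :=
  sqrte (ereal_inf
    [set (\int[gamma]_z (enorm (z.1 - z.2) ^+ 2)%:E)%E
    | gamma in couplings mu nu]).

Definition grad (u : 'rV[R]_d -> R) x : 'rV[R]_d :=
  \row_i 'D_(delta_mx 0 i) u x.

Definition elipschitz (g : 'rV[R]_d -> 'rV[R]_d) : set R :=
  [set k | 0 <= k /\ forall x y, enorm (g x - g y) <= k * enorm (x - y)].

Definition lip (g : 'rV[R]_d -> 'rV[R]_d) : \bar R :=
  ereal_inf [set k%:E | k in elipschitz g].

Definition C11 : set ('rV[R]_d -> R) :=
  [set u | [/\ forall x, differentiable u x,
               continuous (grad u)
             & elipschitz (grad u) !=set0]].

(* For mu and nu in P2, every u in C11 grows at most quadratically, so both
   integrals are finite. *)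
Definition Z2 mu nu : \bar R :=
  ereal_sup [set (\int[nu]_x (u x)%:E - \int[mu]_x (u x)%:E)%E
            | u in [set u | C11 u /\ (lip (grad u) <= 1)%E]].

End definitions.

(* Main.v *)
Require Import Defs.
From HB Require Import structures.
From mathcomp Require Import all_boot all_order all_algebra.
From mathcomp Require Import all_classical all_reals all_analysis.
From mathcomp Require Import measurable_realfun ring lra.
Import Order.TTheory GRing.Theory Num.Theory.
Import numFieldNormedType.Exports.
Local Open Scope classical_set_scope.
Local Open Scope ring_scope.

(** Let m be the common barycentre, S the mean of the two variances, and let u
    have a 1-Lipschitz gradient.  Adding an affine function to u does not
    change the difference of its integrals against nu and mu, so one may
    suppose that the gradient of u vanishes at m; then its value at a point z
    has norm at most |z - m|.  Along the segment z_t from x to y, Young's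
    inequality with a parameter l > 0 bounds the derivative of t |-> u (z_t) by
    (l / 2) |y - x|^2 + |z_t - m|^2 / (2 l).  The mean over t of |z_t - m|^2 is
    (|x - m|^2 + |y - m|^2) / 2 - |y - x|^2 / 6, which gives the pointwise
    inequality [segment_bound].  Dropping the term -|y - x|^2 / 6 would still
    yield the announced inequality; keeping it makes the inequality strict.

    Integrating against a coupling of cost c gives ([coupling_bound])
      int u d(nu - mu) <= (l / 2) c + (S - c / 6) / (2 l),
    and letting c tend to w, the square of W_2, the same bound holds for Z_2
    with w in place of c ([Z2_bound]).  No optimal coupling is needed.  The
    choice l = sqrt (S / w) shows that Z_2 is less than sqrt S * sqrt w by at
    least w sqrt w / (12 sqrt S) when S and w are positive, and S = 0 is only
    possible with w = 0 since Z_2 is nonnegative ([le_sqrtM_young]): equality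
    forces w = 0.

    Finally W_2 = 0 forces mu = nu ([small_coupling_eq]).  A coupling of small
    cost puts little mass on pairs at distance at least e, by Markov's
    inequality, so that mu F is at most the nu-measure of the e-neighbourhood
    of F; for F closed, e -> 0 gives mu F <= nu F.  By symmetry the measures
    agree on closed sets, hence on Borel sets.  Conversely, if mu = nu then
    both distances are zero, as the diagonal coupling shows for W_2. *)

(** * Smooth functions along segments *)

Section pointwise.
Context {R : realType} {d : nat}.
Implicit Types (x y m : 'rV[R]_d) (u : 'rV[R]_d -> R).

Definition dotp (a x : 'rV[R]_d) : R := \sum_i a 0 i * x 0 i.

Lemma dotpB (a x y : 'rV[R]_d) : dotp a (x - y) = dotp a x - dotp a y.
Proof.
by rewrite /dotp -sumrB; apply: eq_bigr => i _; rewrite !mxE mulrBr.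
Qed.

Lemma sqr_enorm x : enorm x ^+ 2 = \sum_i x 0 i ^+ 2.
Proof. by rewrite sqr_sqrtr// sumr_ge0// => i _; rewrite sqr_ge0. Qed.

Lemma sqr_enormC x y : enorm (x - y) ^+ 2 = enorm (y - x) ^+ 2.
Proof. by rewrite !sqr_enorm; apply: eq_bigr => i _; rewrite !mxE; ring. Qed.

Lemma sqr_enorm0 : enorm (0 : 'rV[R]_d) ^+ 2 = 0.
Proof. by rewrite sqr_enorm big1// => i _; rewrite mxE expr0n. Qed.

Lemma sqr_enormB_le x y :
  enorm (x - y) ^+ 2 <= 2 * (enorm x ^+ 2 + enorm y ^+ 2).
Proof.
rewrite !sqr_enorm -big_split/= mulr_sumr ler_sum// => i _; rewrite !mxE.
by rewrite -subr_ge0 (_ : _ - _ = (x 0 i + y 0 i) ^+ 2) ?sqr_ge0//; ring.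
Qed.

Lemma enorm_ge0 x : 0 <= enorm x. Proof. exact: sqrtr_ge0. Qed.

(** [lip] is an infimum of admissible constants, so 1 itself is reached only as
    a limit of admissible constants k > 1. *)
Lemma lip_le1 (g : 'rV[R]_d -> 'rV[R]_d) x y : (lip g <= 1)%E ->
  enorm (g x - g y) <= enorm (x - y).
Proof.
move=> lipg; apply/ler_addgt0Pr => e e0.
have N0 : 0 < enorm (x - y) + 1 by rewrite ltr_wpDl// enorm_ge0.
have : (lip g < (1 + e / (enorm (x - y) + 1))%:E)%E.
  by rewrite (le_lt_trans lipg)// lte_fin ltrDl divr_gt0.
move=> /ereal_inf_lt[_ [k [k0 gk] <-]]; rewrite lte_fin => ke.
apply: (le_trans (gk x y)).
apply: (@le_trans _ _ ((1 + e / (enorm (x - y) + 1)) * enorm (x - y))).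
  by rewrite ler_wpM2r ?enorm_ge0// ltW.
rewrite mulrDl mul1r lerD2l mulrAC ler_pdivrMr//.
by rewrite mulrDr mulr1 lerDl ltW.
Qed.

Lemma derive_gradE u x v : differentiable u x ->
  'D_v u x = dotp (grad u x) v.
Proof.
move=> du; rewrite deriveE// [X in 'd u x X]row_sum_delta linear_sum.
by apply: eq_bigr => i _; rewrite linearZ mxE deriveE// mulrC.
Qed.

Lemma is_derive_segment u x v (t : R) : differentiable u (x + t *: v) ->
  is_derive t 1 (fun s => u (x + s *: v)) (dotp (grad u (x + t *: v)) v).
Proof.
move=> du; rewrite -derive_gradE//.
have E : (fun h : R => h^-1 *:
    (((fun s => u (x + s *: v)) \o shift t) (h *: 1) - u (x + t *: v))) =
  (fun h : R => h^-1 *: ((u \o shift (x + t *: v)) (h *: v) - u (x + t *: v))).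
  apply/funext => h /=; congr (_ *: (u _ - _)).
  by rewrite [h%:A]mulr1 scalerDl addrCA addrC.
apply: DeriveDef; last by rewrite /derive E.
rewrite /derivable E; exact: diff_derivable.
Qed.

(** The increment of t |-> u (x + t (y - x)) is compared with that of the cubic
    polynomial whose derivative dominates by Young's inequality; comparing
    derivatives avoids integrating in t.  The point m is arbitrary here: it
    serves as the base point of the linear part removed from u. *)
Lemma segment_bound u m x y (l : R) : (forall z, differentiable u z) ->
  (lip (grad u) <= 1)%E -> 0 < l ->
  u y - u x - dotp (grad u m) (y - x) <=
  l / 2 * enorm (y - x) ^+ 2 +
  ((enorm (x - m) ^+ 2 + enorm (y - m) ^+ 2) / 2 - enorm (y - x) ^+ 2 / 6) /
    (2 * l).
Proof.
move=> du lipu l0.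
pose b := y - x; pose p := x - m.
pose A := enorm p ^+ 2; pose B := enorm b ^+ 2; pose D := dotp p b.
pose G := dotp (grad u m) b.
have expand (t : R) : enorm (p + t *: b) ^+ 2 = A + 2 * D * t + B * t ^+ 2.
  rewrite /A /B /D /dotp !sqr_enorm mulr_sumr !mulr_suml -!big_split/=.
  by apply: eq_bigr => i _; rewrite !mxE; ring.
have Ey : enorm (y - m) ^+ 2 = A + 2 * D + B.
  rewrite (_ : y - m = p + 1 *: b) ?expand; first ring.
  by rewrite scale1r /p /b; apply/rowP => i; rewrite !mxE; ring.
(* P is the primitive vanishing at 0 of the upper bound
   G + l / 2 * B + enorm (p + t *: b) ^+ 2 / (2 * l) of the derivative. *)
pose P : {poly R} := (G + l / 2 * B + A / (2 * l)) *: 'X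
  + (D / (2 * l)) *: 'X^2 + (B / (6 * l)) *: 'X^3.
pose F : R -> R := (fun s => u (x + s *: b)) - horner P.
pose dF t := dotp (grad u (x + t *: b)) b - (deriv P).[t].
have FdF (t : R) : is_derive t (1 : R) F (dF t).
  by apply: is_deriveB; exact: is_derive_segment.
have dF_le0 t : dF t <= 0.
  have Pt : (deriv P).[t] = G + l / 2 * B + enorm (p + t *: b) ^+ 2 / (2 * l).
    rewrite expand /P !derivD !derivZ derivX !derivXn !hornerE /=.
    by field; rewrite gt_eqF.
  have lipt : enorm (grad u (x + t *: b) - grad u m) ^+ 2 <=
      enorm (p + t *: b) ^+ 2.
    rewrite ler_sqr ?nnegrE ?enorm_ge0//.
    rewrite (_ : p + t *: b = x + t *: b - m); first exact: lip_le1.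
    by rewrite /p addrAC.
  have young : dotp (grad u (x + t *: b) - grad u m) b <=
      l / 2 * B + enorm (grad u (x + t *: b) - grad u m) ^+ 2 / (2 * l).
    rewrite /B /dotp !sqr_enorm mulr_sumr mulr_suml -big_split/= ler_sum// => i _.
    set a := fun_of_matrix (_ - _) 0 i; rewrite -subr_ge0.
    have -> : l / 2 * b 0 i ^+ 2 + a ^+ 2 / (2 * l) - a * b 0 i =
      (l * b 0 i - a) ^+ 2 / (2 * l) by field; rewrite gt_eqF.
    by rewrite divr_ge0 ?sqr_ge0// mulr_ge0// ltW.
  have GE : dotp (grad u (x + t *: b)) b =
      G + dotp (grad u (x + t *: b) - grad u m) b.
    by rewrite /G /dotp -big_split/=; apply: eq_bigr => i _; rewrite !mxE; ring.
  rewrite /dF subr_le0 GE Pt -addrA lerD2l (le_trans young)// lerD2l.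
  by rewrite ler_pM2r// invr_gt0 mulr_gt0.
have [||c _] := @MVT R F dF 0 1.
- exact: ltr01.
- apply: continuous_subspaceT => t.
  apply/differentiable_continuous/derivable1_diffP.
  by have [] := FdF t.
rewrite subr0 mulr1 => E; have := dF_le0 c; rewrite -E subr_le0.
have P1 : P.[1] = G + l / 2 * B + A / (2 * l) + D / (2 * l) + B / (6 * l).
  by rewrite /P !hornerE/= ?expr1n; ring.
have P0 : P.[0] = 0 by rewrite /P !hornerE/=; ring.
rewrite /F !fctE scale1r scale0r addr0 P1 P0 [x + b]addrC subrK.
rewrite Ey -/p -/A -/b -/B -/G => H.
apply: (@le_trans _ _ (l / 2 * B + A / (2 * l) + D / (2 * l) + B / (6 * l))).
  lra.
by rewrite le_eqVlt; apply/orP; left; apply/eqP; field; rewrite gt_eqF.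
Qed.

End pointwise.

(** * Image measures and integrability *)

Section transport.
Context {d1 d2 : measure_display} {X : measurableType d1} {Y : measurableType d2}
  {R : realType} {P : {measure set X -> \bar R}} {Q : {measure set Y -> \bar R}}.
Variable phi : X -> Y.
Hypothesis mphi : measurable_fun [set: X] phi.
Hypothesis phiPQ : forall A, measurable A -> pushforward P phi A = Q A.

(** The measures [pushforward P phi] and [Q] are only known to agree on
    measurable sets, so integrals have to be carried from one to the other. *)
Lemma transport_ge0_integral (f : Y -> \bar R) : measurable_fun [set: Y] f ->
  (forall y, 0 <= f y)%E -> (\int[P]_x f (phi x) = \int[Q]_y f y)%E.
Proof.
move=> mf f0; rewrite [RHS](eq_measure_integral (pushforward P phi)).
  by rewrite [RHS](ge0_integral_pushforward mphi)// => y _.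
by move=> A mA _; rewrite -phiPQ.
Qed.

Lemma transport_integrable (f : Y -> R) : Q.-integrable setT (EFin \o f) ->
  P.-integrable setT (EFin \o (f \o phi)).
Proof.
move=> /integrableP[mf foo]; apply/integrableP; split.
  exact: (measurableT_comp mf).
rewrite (transport_ge0_integral (fun y => `|(f y)%:E|)%E)//.
exact: measurableT_comp.
Qed.

Lemma transport_Rintegral (f : Y -> R) : Q.-integrable setT (EFin \o f) ->
  \int[P]_x f (phi x) = \int[Q]_y f y.
Proof.
move=> fi; congr fine; rewrite [RHS](eq_measure_integral (pushforward P phi)).
  rewrite [RHS](integral_pushforward mphi)//; first by case/integrableP: fi.
  exact: transport_integrable.
by move=> A mA _; rewrite -phiPQ.
Qed.

End transport.

Section borel.
Context {R : realType} {d : nat}.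

Lemma open_measurable_rV (A : set 'rV[R]_d) : open A -> measurable A.
Proof. by move=> oA; exact: sub_sigma_algebra. Qed.

Lemma continuous_measurable_rV (f : 'rV[R]_d -> R) : continuous f ->
  measurable_fun setT f.
Proof.
move=> /continuousP cf; apply: (measurability _ (RGenOpens.measurableE R)).
move=> _ [_ [a [b ->]] <-]; rewrite setTI; apply: open_measurable_rV.
exact/cf/interval_open.
Qed.

Lemma measurable_coord (i : 'I_d) :
  measurable_fun setT (fun x : 'rV[R]_d => x 0 i).
Proof. by apply: continuous_measurable_rV; exact: coord_continuous. Qed.

(** Composing coordinate functions with f and g shows measurability for the product
    sigma-algebra directly, without comparing it with the Borel one. *)
Lemma measurable_sqr_enormB d0 (T : measurableType d0) (f g : T -> 'rV[R]_d) :
  measurable_fun [set: T] f -> measurable_fun [set: T] g ->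
  measurable_fun [set: T] (fun t => enorm (f t - g t) ^+ 2).
Proof.
move=> mf mg; under eq_fun do rewrite sqr_enorm.
apply: measurable_sum => i; apply: measurable_funX.
under eq_fun do rewrite !mxE.
by apply: measurable_funB; apply: (measurableT_comp (measurable_coord i)).
Qed.

End borel.

Section integrals.
Context {R : realType} {d : nat}.
Implicit Types (mu nu : probability 'rV[R]_d R) (x y m : 'rV[R]_d).

Lemma P2_integrable mu m : P2 mu ->
  mu.-integrable setT (EFin \o (fun x => enorm (x - m) ^+ 2)).
Proof.
have mN (v : 'rV[R]_d) :
    measurable_fun setT (fun x : 'rV[R]_d => enorm (x - v) ^+ 2).
  by apply: measurable_sqr_enormB => //; exact: measurable_id.
move=> mu2.
have mu0 : mu.-integrable setT (EFin \o (fun x => enorm (x - 0) ^+ 2)).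
  apply/integrableP; split; first exact/measurable_EFinP.
  under eq_integral do rewrite /= ger0_norm ?sqr_ge0// subr0.
  exact: mu2.
have c1 := finite_measure_integrable_cst mu (enorm m ^+ 2) measurableT.
apply: (le_integrable measurableT _ _
  (integrableZl measurableT 2 (integrableD measurableT mu0 c1))).
  exact/measurable_EFinP.
move=> x _ /=; rewrite lee_fin subr0 [leLHS]ger0_norm ?sqr_ge0// ger0_norm.
  exact: sqr_enormB_le.
by rewrite mulr_ge0// addr_ge0// sqr_ge0.
Qed.

(** Because |t| <= 1 + t^2. *)
Lemma P2_integrable_coord mu (i : 'I_d) : P2 mu ->
  mu.-integrable setT (EFin \o (fun x => x 0 i)).
Proof.
move=> mu2; have c1 := finite_measure_integrable_cst mu (1 : R) measurableT.
apply: (le_integrable measurableT _ _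
  (integrableD measurableT c1 (P2_integrable _ 0 mu2))).
  by apply/measurable_EFinP; exact: measurable_coord.
move=> x _ /=; rewrite lee_fin subr0 [leRHS]ger0_norm ?addr_ge0 ?sqr_ge0//.
apply: (@le_trans _ _ (1 + x 0 i ^+ 2)).
  rewrite -[X in _ + X]real_normK ?num_real// -subr_ge0.
  rewrite (_ : _ - _ = (`|x 0 i| - 2^-1) ^+ 2 + 3 / 4); last by field.
  by rewrite addr_ge0 ?sqr_ge0.
rewrite lerD2l sqr_enorm (bigD1 i)//= lerDl sumr_ge0// => j _; exact: sqr_ge0.
Qed.

Lemma integrable_sumr d0 (T : measurableType d0) (P : {measure set T -> \bar R})
  n (f : 'I_n -> T -> R) : (forall i, P.-integrable setT (EFin \o f i)) ->
  P.-integrable setT (EFin \o (fun t => \sum_i f i t)).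
Proof.
move=> fi; rewrite (_ : _ \o _ = fun t => (\sum_i (f i t)%:E)%E).
  by apply: integrable_sum => // i _; exact: fi.
by apply/funext => t /=; rewrite sumEFin.
Qed.

Lemma Rintegral_sum d0 (T : measurableType d0) (P : {measure set T -> \bar R})
  n (f : 'I_n -> T -> R) : (forall i, P.-integrable setT (EFin \o f i)) ->
  \int[P]_t (\sum_i f i t) = \sum_i \int[P]_t f i t.
Proof.
move=> fi; rewrite /Rintegral; under eq_integral do rewrite -sumEFin.
rewrite integral_sum// sum_fine// => i _.
exact: (integrable_fin_num measurableT (fi i)).
Qed.

Lemma P2_integrable_dotp mu a : P2 mu -> mu.-integrable setT (EFin \o dotp a).
Proof.
move=> mu2; apply: integrable_sumr => i.
exact: (integrableZl measurableT (a 0 i) (P2_integrable_coord _ i mu2)).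
Qed.

Lemma Rintegral_dotp mu a : P2 mu -> \int[mu]_x dotp a x = dotp a (barycentre mu).
Proof.
move=> mu2; rewrite Rintegral_sum => [|i].
  apply: eq_bigr => i _; rewrite RintegralZl ?mxE//.
  exact: P2_integrable_coord.
exact: (integrableZl measurableT (a 0 i) (P2_integrable_coord _ i mu2)).
Qed.

End integrals.

(** * Integrating the pointwise bound against a coupling *)

Section main_bound.
Context {R : realType} {d : nat}.
Implicit Types (x y m : 'rV[R]_d) (u : 'rV[R]_d -> R) (l : R).

(** The case l = 1 of [segment_bound] with an end of the segment at m: removing
    the linear part at m leaves a quadratically growing function, which is
    therefore integrable against every measure in P2. *)
Lemma smooth_growth u m y : (forall z, differentiable u z) ->
  (lip (grad u) <= 1)%E ->
  `|(u y - dotp (grad u m) y) - (u m - dotp (grad u m) m)| <=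
  enorm (y - m) ^+ 2.
Proof.
move=> du lipu.
have := segment_bound u m m y _ du lipu ltr01.
have := segment_bound u m y m _ du lipu ltr01.
rewrite subrr sqr_enorm0 (sqr_enormC m y) !dotpB => h1 h2.
have := sqr_ge0 (enorm (y - m)).
by rewrite ler_norml; lra.
Qed.

Section tangent.
Variables (u : 'rV[R]_d -> R) (mu : probability 'rV[R]_d R) (m : 'rV[R]_d).
Hypotheses (du : forall z, differentiable u z) (lipu : (lip (grad u) <= 1)%E).
Hypothesis (mu2 : P2 mu).

Lemma tangent_integrable :
  mu.-integrable setT (EFin \o (fun x => u x - dotp (grad u m) x)).
Proof.
pose k := u m - dotp (grad u m) m.
have ik := finite_measure_integrable_cst mu `|k| measurableT.
apply: (le_integrable measurableT _ _
  (integrableD measurableT (P2_integrable _ m mu2) ik)).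
  apply/measurable_EFinP/measurable_funB.
    by apply: continuous_measurable_rV => x; exact: differentiable_continuous.
  apply/measurable_EFinP.
  by case/integrableP: (P2_integrable_dotp _ (grad u m) mu2).
move=> x _ /=; rewrite lee_fin [leRHS]ger0_norm ?addr_ge0 ?sqr_ge0//.
rewrite -[leLHS](@subrK _ `|k|) lerD2r (le_trans (lerB_dist _ _))//.
exact: smooth_growth.
Qed.

Lemma smooth_integrable : mu.-integrable setT (EFin \o u).
Proof.
rewrite (_ : u = (fun x => (u x - dotp (grad u m) x) + dotp (grad u m) x)).
  exact: (integrableD measurableT tangent_integrable
    (P2_integrable_dotp _ _ mu2)).
by apply/funext => x; rewrite subrK.
Qed.

Lemma Rintegral_tangent : \int[mu]_x (u x - dotp (grad u m) x) =
  \int[mu]_x u x - dotp (grad u m) (barycentre mu).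
Proof.
rewrite RintegralB ?Rintegral_dotp//.
  exact: smooth_integrable.
exact: P2_integrable_dotp.
Qed.

End tangent.

Definition cost (gamma : probability ('rV[R]_d * 'rV[R]_d)%type R) : R :=
  \int[gamma]_z enorm (z.1 - z.2) ^+ 2.

Variables mu nu : probability 'rV[R]_d R.
Hypotheses (mu2 : P2 mu) (nu2 : P2 nu).
Variable gamma : probability ('rV[R]_d * 'rV[R]_d)%type R.
Hypothesis gmn : couplings mu nu gamma.

Let fstP A : measurable A -> pushforward gamma fst A = mu A.
Proof. by move=> /gmn[]. Qed.
Let sndP A : measurable A -> pushforward gamma snd A = nu A.
Proof. by move=> /gmn[]. Qed.

Lemma coupling_cost_integrable :
  gamma.-integrable setT (EFin \o (fun z => enorm (z.1 - z.2) ^+ 2)).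
Proof.
have i1 := transport_integrable _ measurable_fst fstP _ (P2_integrable _ 0 mu2).
have i2 := transport_integrable _ measurable_snd sndP _ (P2_integrable _ 0 nu2).
apply: (le_integrable measurableT _ _
  (integrableZl measurableT 2 (integrableD measurableT i1 i2))).
  apply/measurable_EFinP/measurable_sqr_enormB.
    exact: measurable_fst.
  exact: measurable_snd.
move=> z _ /=; rewrite lee_fin !subr0 [leLHS]ger0_norm ?sqr_ge0// ger0_norm.
  exact: sqr_enormB_le.
by rewrite mulr_ge0// addr_ge0// sqr_ge0.
Qed.

Lemma cost_EFin :
  (\int[gamma]_z (enorm (z.1 - z.2) ^+ 2)%:E = (cost gamma)%:E)%E.
Proof.
rewrite /cost /Rintegral fineK//.
exact: (integrable_fin_num measurableT coupling_cost_integrable).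
Qed.

(** The removed linear part has the same integral against mu and nu because
    the barycentres agree; this is where that hypothesis enters. *)
Lemma coupling_bound u l : barycentre mu = barycentre nu ->
  (forall z, differentiable u z) -> (lip (grad u) <= 1)%E -> 0 < l ->
  \int[nu]_x u x - \int[mu]_x u x <= l / 2 * cost gamma +
    ((fine (var mu) + fine (var nu)) / 2 - cost gamma / 6) / (2 * l).
Proof.
move=> bar du lipu l0; set c := cost gamma.
pose m := barycentre mu; pose v := fun x => u x - dotp (grad u m) x.
have -> : fine (var mu) = \int[mu]_x enorm (x - m) ^+ 2 by [].
have -> : fine (var nu) = \int[nu]_x enorm (x - m) ^+ 2 by rewrite /m bar.
have -> : \int[nu]_x u x - \int[mu]_x u x = \int[nu]_x v x - \int[mu]_x v x.
  rewrite !Rintegral_tangent// -bar; ring.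
have imu := tangent_integrable _ _ m du lipu mu2.
have inu := tangent_integrable _ _ m du lipu nu2.
have iv1 := transport_integrable _ measurable_fst fstP _ imu.
have iv2 := transport_integrable _ measurable_snd sndP _ inu.
have i1 := transport_integrable _ measurable_fst fstP _ (P2_integrable _ m mu2).
have i2 := transport_integrable _ measurable_snd sndP _ (P2_integrable _ m nu2).
rewrite -(transport_Rintegral _ measurable_fst fstP v)//.
rewrite -(transport_Rintegral _ measurable_snd sndP v)//.
rewrite -RintegralB//.
(* The right-hand side of segment_bound as a combination of the transport cost
   and of the two squared distances to m. *)
pose a := l / 2 - (12 * l)^-1; pose b := (4 * l)^-1.
have iD := integrableD measurableT i1 i2.
have ia := integrableZl measurableT a coupling_cost_integrable.
have ib := integrableZl measurableT b iD.
have -> : l / 2 * c + ((\int[mu]_x enorm (x - m) ^+ 2 +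
    \int[nu]_x enorm (x - m) ^+ 2) / 2 - c / 6) / (2 * l) =
    \int[gamma]_z (a * enorm (z.1 - z.2) ^+ 2 +
      b * (enorm (z.1 - m) ^+ 2 + enorm (z.2 - m) ^+ 2)).
  rewrite RintegralD// !RintegralZl//; [|exact: coupling_cost_integrable].
  rewrite RintegralD//.
  pose sqd x := enorm (x - m) ^+ 2.
  rewrite (transport_Rintegral _ measurable_fst fstP sqd) ?P2_integrable//.
  rewrite (transport_Rintegral _ measurable_snd sndP sqd) ?P2_integrable//.
  rewrite -/(cost gamma) -/c /a /b; field; rewrite gt_eqF//.
apply: le_Rintegral => //.
- exact: (integrableB measurableT iv2 iv1).
- exact: (integrableD measurableT ia ib).
move=> z _ /=; have := segment_bound u m z.1 z.2 _ du lipu l0.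
rewrite dotpB (sqr_enormC z.2).
set A := enorm (z.1 - m) ^+ 2; set B := enorm (z.2 - m) ^+ 2.
set C := enorm (z.1 - z.2) ^+ 2 => H.
have E : a * C + b * (A + B) = l / 2 * C + ((A + B) / 2 - C / 6) / (2 * l).
  by rewrite /a /b; field; rewrite gt_eqF.
by rewrite E /v; move: H; lra.
Qed.

End main_bound.

(** * Couplings of small cost identify the marginals *)

Section identification.
Context {R : realType} {d : nat}.
Local Notation V := ('rV[R]_d).
Implicit Types (mu nu : probability 'rV[R]_d R) (F : set 'rV[R]_d).

(** The balls are those of the sup norm, so that this set is open at once;
    [enorm_lt_ball] makes the comparison with the Euclidean norm. *)
Definition thicken F (e : R) : set V := \bigcup_(x in F) ball x e.

Lemma open_thicken F e : open (thicken F e).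
Proof. by apply: bigcup_open => x _; exact: ball_open. Qed.

Lemma closed_measurable_rV F : closed F -> measurable F.
Proof.
move=> cF; rewrite -(setCK F); apply: measurableC.
by apply: open_measurable_rV; exact: closed_openC.
Qed.

Lemma bigcap_thicken F : closed F -> \bigcap_n thicken F n.+1%:R^-1 = F.
Proof.
move=> cF; apply/seteqP; split => [x Fx|x Fx n _]; last first.
  by exists x => //; apply: ballxx; rewrite invr_gt0.
apply: cF => U /nbhs_ballP[e /= e0 eU].
have /filter_ex[n /= ne] := near_infty_natSinv_lt (PosNum e0).
have [y Fy yx] := Fx n I.
exists y; split => //; apply: eU.
by apply/ball_sym; apply: le_ball yx; exact: ltW.
Qed.

Lemma enorm_lt_ball (x y : V) (e : R) :
  0 < e -> enorm (x - y) ^+ 2 < e ^+ 2 -> ball x e y.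
Proof.
move=> e0 xye; split=> // i j; rewrite /ball/= -(ltr_sqr (normr_ge0 _) (ltW e0)).
apply: le_lt_trans xye; rewrite (ord1 i) sqr_enorm (bigD1 j)//= !mxE.
by rewrite real_normK ?num_real// lerDl sumr_ge0// => k _; exact: sqr_ge0.
Qed.

(** If f lies in F and g does not lie in the e-neighbourhood of F, then f and g
    are at distance at least e, which has probability at most eta by Markov's
    inequality.  Random variables f and g replace the two projections so that
    the lemma can be used in both directions. *)
Lemma measure_le_thicken d0 (T : measurableType d0) (P : probability T R)
    (f g : T -> V) F (e eta : R) :
  measurable_fun [set: T] f -> measurable_fun [set: T] g ->
  closed F -> 0 < e ->
  (\int[P]_t (enorm (f t - g t) ^+ 2)%:E <= (e ^+ 2 * eta)%:E)%E ->
  (P (f @^-1` F) <= P (g @^-1` thicken F e) + eta%:E)%E.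
Proof.
move=> mf mg cF e0 fg.
pose N t := enorm (f t - g t) ^+ 2.
have mN : measurable_fun [set: T] N by exact: measurable_sqr_enormB.
pose B := [set t | ((e ^+ 2)%:E <= `|(N t)%:E|)%E].
have mB : measurable B.
  rewrite -[B]setTI; apply: emeasurable_fun_c_infty => //.
  by apply: measurableT_comp => //; exact/measurable_EFinP.
have mfF : measurable (f @^-1` F).
  rewrite -[X in measurable X]setTI; apply: mf => //.
  exact: closed_measurable_rV.
have mgF : measurable (g @^-1` thicken F e).
  rewrite -[X in measurable X]setTI; apply: mg => //.
  by apply: open_measurable_rV; exact: open_thicken.
have markov : (P B <= eta%:E)%E.
  rewrite -(@lee_pmul2l _ (e ^+ 2)%:E)//; last by rewrite lte_fin exprn_gt0.
  rewrite -EFinM (le_trans _ fg)//.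
  have := @le_integral_comp_abse _ _ _ P setT measurableT (EFin \o N) (e ^+ 2) id.
  rewrite setTI => /(_ _ _ _ _ _)/le_trans; apply => //.
  - by apply/measurable_EFinP.
  - by rewrite exprn_gt0.
  - by under eq_integral do rewrite /= ger0_norm ?sqr_ge0//.
apply: (@le_trans _ _ (P (g @^-1` thicken F e `|` B))).
  apply: le_measure; rewrite ?inE//; first exact: measurableU.
  move=> t /= Ft; have [tB|tB] := pselect (B t); [by right|left].
  exists (f t) => //; apply: enorm_lt_ball => //.
  move/negP: tB; rewrite -ltNge lte_fin ger0_norm//; exact: sqr_ge0.
by apply: (le_trans (measureU2 _ mgF mB)); rewrite leeD2l.
Qed.

(** Continuity from above along the neighbourhoods of radius 1 / (n + 1), whose
    intersection is the closed set F. *)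
Lemma closed_measure_le mu nu F : closed F ->
  (forall e eta : R, 0 < e -> 0 < eta -> (mu F <= nu (thicken F e) + eta%:E)%E) ->
  (mu F <= nu F)%E.
Proof.
move=> cF h.
have mT n : measurable (thicken F n.+1%:R^-1).
  by apply: open_measurable_rV; exact: open_thicken.
have : nu \o (fun n => thicken F n.+1%:R^-1) @ \oo -->
    nu (\bigcap_n thicken F n.+1%:R^-1).
  apply: nonincreasing_cvg_mu => //.
  - by rewrite -ge0_fin_numE// fin_num_measure.
  - by rewrite bigcap_thicken//; exact: closed_measurable_rV.
  move=> m n mn; apply/subsetPset => x [y Fy yx]; exists y => //.
  by apply: le_ball yx; rewrite lef_pV2 ?posrE// ler_nat ltnS.
rewrite bigcap_thicken// => /cvge_to_ge; apply; near=> n => /=.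
by apply/lee_addgt0Pr => eta eta0; apply: h.
Unshelve. all: by end_near. Qed.

Lemma closed_measure_unique mu nu : (forall F, closed F -> mu F = nu F) ->
  forall A, measurable A -> mu A = nu A.
Proof.
move=> h; apply: (measure_unique (open : set (set V)) (fun=> setT)) => //.
- by move=> A B; exact: openI.
- by move=> _; exact: openT.
- by rewrite bigcup_const//; exists 0%N.
- move=> A oA; rewrite -(setCK A).
  have mC : measurable (~` A) by apply: measurableC; exact: open_measurable_rV.
  apply: etrans (probability_setC mu mC) _.
  apply: etrans _ (esym (probability_setC nu mC)).
  by rewrite h//; exact: open_closedC.
- by move=> _; rewrite -ge0_fin_numE// fin_num_measure.
Qed.

Lemma small_coupling_eq mu nu :
  (forall e : R, 0 < e -> exists2 gamma, couplings mu nu gamma &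
     (\int[gamma]_z (enorm (z.1 - z.2) ^+ 2)%:E < e%:E)%E) ->
  forall A, measurable A -> mu A = nu A.
Proof.
move=> small; apply: closed_measure_unique => F cF.
have mF := closed_measurable_rV F cF.
have mT e : measurable (thicken F e).
  by apply: open_measurable_rV; exact: open_thicken.
apply/eqP; rewrite eq_le.
apply/andP; split; apply: closed_measure_le => // e eta e0 eta0.
  have [|gamma g12 cost_lt] := small (e ^+ 2 * eta).
    by rewrite mulr_gt0// exprn_gt0.
  have [<- _] := g12 _ mF; have [_ <-] := g12 _ (mT e).
  by apply: measure_le_thicken => //; exact: ltW.
have [|gamma g12 cost_lt] := small (e ^+ 2 * eta).
  by rewrite mulr_gt0// exprn_gt0.
have [_ <-] := g12 _ mF; have [<- _] := g12 _ (mT e).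
apply: measure_le_thicken => //; apply: ltW; apply: le_lt_trans cost_lt.
by under eq_integral do rewrite sqr_enormC.
Qed.

End identification.

(** * Product and diagonal couplings *)

Section couplings_examples.
Context {R : realType} {d : nat}.
Implicit Types (mu nu : probability 'rV[R]_d R).

Lemma product_coupling mu nu : couplings mu nu (mu \x nu)%E.
Proof.
move=> A mA; rewrite /pushforward; split.
  rewrite (_ : fst @^-1` A = A `*` setT).
    apply: etrans (product_measure1E mu nu mA measurableT) _.
    by rewrite -[RHS]mule1; congr (_ * _)%E; exact: probability_setT.
  by apply/seteqP; split => -[x y] //= [].
rewrite (_ : snd @^-1` A = setT `*` A).
  apply: etrans (product_measure1E mu nu measurableT mA) _.
  by rewrite -[RHS]mul1e; congr (_ * _)%E; exact: probability_setT.
by apply/seteqP; split => -[x y] //= [].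
Qed.

Lemma diagonal_coupling mu nu : (forall A, measurable A -> mu A = nu A) ->
  exists2 gamma, couplings mu nu gamma &
    (\int[gamma]_z (enorm (z.1 - z.2) ^+ 2)%:E = 0)%E.
Proof.
move=> munu.
have mdiag : measurable_fun [set: 'rV[R]_d] (fun x : 'rV[R]_d => (x, x)).
  by apply: measurable_fun_pair; exact: measurable_id.
pose f := mfun_Sub (mem_set mdiag).
exists (distribution mu f) => [A mA|].
  by split => //; rewrite -munu.
rewrite -(transport_ge0_integral f mdiag (fun _ _ => erefl)).
- by apply: integral0_eq => x _ /=; rewrite subrr sqr_enorm0.
- exact: mdiag.
- apply/measurable_EFinP/measurable_sqr_enormB.
    exact: measurable_fst.
  exact: measurable_snd.
- by move=> z; rewrite lee_fin sqr_ge0.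
Qed.

End couplings_examples.

(** * Optimizing the parameter *)

(** For S and w positive, l = sqrt (S / w) makes the first two terms add up to
    sqrt S * sqrt w and leaves the negative term - w / (12 l). *)
Lemma le_sqrtM_young (R : rcfType) (Z S w : R) : 0 <= Z -> 0 <= S -> 0 <= w ->
  (forall l, 0 < l -> Z <= l / 2 * w + (S - w / 6) / (2 * l)) ->
  Z <= Num.sqrt S * Num.sqrt w /\ (Z = Num.sqrt S * Num.sqrt w -> w = 0).
Proof.
move=> Z0 S0; rewrite le_eqVlt => /predU1P[<- h|w0 h].
  rewrite sqrtr0 mulr0; split=> //; rewrite leNgt; apply/negP => Zgt0.
  (* For w = 0 the bound is S / (2 * l), which this l makes smaller than Z. *)
  have l0 : 0 < (S + 1) / Z by rewrite divr_gt0// ltr_wpDl.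
  have l20 : 0 < 2 * ((S + 1) / Z) by rewrite mulr_gt0.
  have := h _ l0; rewrite mulr0 mul0r add0r subr0 ler_pdivlMr//.
  rewrite (_ : Z * _ = 2 * (S + 1)); last by field; rewrite gt_eqF.
  lra.
move: S0; rewrite le_eqVlt => /predU1P[S0|S0].
  (* For S = 0 and w > 0 a small l makes the bound negative: at 1 / 4 it is
     w / 8 - w / 3. *)
  by have := h (1 / 4) ltac:(lra); rewrite -S0; lra.
set s := Num.sqrt S; set r := Num.sqrt w.
have s0 : 0 < s by rewrite /s sqrtr_gt0.
have r0 : 0 < r by rewrite /r sqrtr_gt0.
have Ss : S = s ^+ 2 by rewrite /s sqr_sqrtr// ltW.
have wr : w = r ^+ 2 by rewrite /r sqr_sqrtr// ltW.
suff : Z < s * r.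
  by move=> lt; split; [exact: ltW|move=> E; rewrite E ltxx in lt].
apply: le_lt_trans (h (s / r) _) _; first by rewrite divr_gt0.
rewrite Ss wr -subr_gt0 (_ : _ - _ = r ^+ 3 / (12 * s)).
  by rewrite divr_gt0 ?exprn_gt0// mulr_gt0.
by field; rewrite !gt_eqF.
Qed.

(** * The two distances *)

Local Open Scope ereal_scope.

Section distances.
Context {R : realType} {d : nat}.
Variables mu nu : probability 'rV[R]_d R.

(** The null function is admissible. *)
Lemma Z2_ge0 : 0 <= Z2 mu nu.
Proof.
apply: ereal_sup_ubound; exists (cst 0%R); last first.
  by rewrite !integral0 subee.
have g0 x : grad (cst 0%R : 'rV[R]_d -> R) x = 0%R.
  by apply/rowP => i; rewrite !mxE derive_cst.
have lip1 : elipschitz (grad (cst 0%R : 'rV[R]_d -> R)) 1%R.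
  split => // x y; rewrite !g0 subrr mul1r.
  by rewrite [leLHS]/enorm -sqr_enorm sqr_enorm0 sqrtr0 enorm_ge0.
split; last by apply: ereal_inf_lbound; exists 1%R.
split; [exact: differentiable_cst| |by exists 1%R].
have -> : grad (cst 0%R : 'rV[R]_d -> R) = cst 0%R by apply/funext.
exact: cst_continuous.
Qed.

Lemma Z2_eq0 : (forall A, measurable A -> mu A = nu A) -> Z2 mu nu = 0.
Proof.
move=> munu; apply/eqP; rewrite eq_le Z2_ge0 andbT.
apply: ge_ereal_sup => _ [u _ <-].
rewrite (eq_measure_integral nu (m1 := mu)) => [|A mA _]; last exact: munu.
(* If the integral is infinite, the difference is +oo - +oo = -oo. *)
case: (\int[nu]_x (u x)%:E) => [r| |].
- by rewrite subee.
- exact: leNye.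
- exact: leNye.
Qed.

Lemma W2_eq0 : (forall A, measurable A -> mu A = nu A) -> W2 mu nu = 0.
Proof.
move=> /diagonal_coupling[gamma gmn cost0]; rewrite /W2.
rewrite (_ : ereal_inf _ = 0) ?sqrte0//.
apply/eqP; rewrite eq_le; apply/andP; split.
  by apply: ereal_inf_lbound; exists gamma.
apply: le_ereal_inf_tmp => _ [g _ <-]; apply: integral_ge0 => z _.
by rewrite lee_fin sqr_ge0.
Qed.

Hypotheses (mu2 : P2 mu) (nu2 : P2 nu).

Lemma var_fin_num : var mu \is a fin_num.
Proof. exact: (integrable_fin_num measurableT (P2_integrable _ _ mu2)). Qed.

(** The square of W_2 is finite because the product coupling has finite cost; it
    is the limit of the costs of couplings that need not be optimal. *)
Lemma W2_approx : exists2 w : R, (0 <= w)%R & W2 mu nu = (Num.sqrt w)%:E /\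
  forall e : R, (0 < e)%R -> exists2 gamma, couplings mu nu gamma &
    (w <= cost gamma < w + e)%R.
Proof.
rewrite /W2; set C := [set _ | _ in _].
have C0 : 0 <= ereal_inf C.
  apply: le_ereal_inf_tmp => _ [g _ <-]; apply: integral_ge0 => z _.
  by rewrite lee_fin sqr_ge0.
have costE gamma (gmn : couplings mu nu gamma) := cost_EFin _ _ mu2 nu2 _ gmn.
have Cfin : ereal_inf C \is a fin_num.
  rewrite ge0_fin_numE// (@le_lt_trans _ _ (cost (mu \x nu))%:E) ?ltry//.
  apply: ereal_inf_lbound; exists (mu \x nu); first exact: product_coupling.
  by rewrite costE//; exact: product_coupling.
exists (fine (ereal_inf C)); first exact: fine_ge0.
split=> [|e e0]; first by rewrite -[in LHS](fineK Cfin).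
have [_ [gamma gmn <-] ce] := lb_ereal_inf_adherent e0 Cfin.
exists gamma => //; rewrite -lee_fin -lte_fin EFinD fineK// -costE// ce andbT.
by apply: ereal_inf_lbound; exists gamma.
Qed.

(** The cost enters [coupling_bound] once with a positive sign, where it exceeds
    w by an arbitrarily small amount, and once with a negative sign, where it
    is at least w; so no sign condition on the total coefficient arises. *)
Lemma Z2_bound (w l : R) : barycentre mu = barycentre nu -> (0 < l)%R ->
  (forall e : R, (0 < e)%R -> exists2 gamma, couplings mu nu gamma &
    (w <= cost gamma < w + e)%R) ->
  Z2 mu nu <=
    (l / 2 * w + ((fine (var mu) + fine (var nu)) / 2 - w / 6) / (2 * l))%R%:E.
Proof.
move=> bar l0 approx; apply: ge_ereal_sup => _ [u [[du _ _] lipu] <-].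
have uE (rho : probability 'rV[R]_d R) : P2 rho ->
    \int[rho]_x (u x)%:E = (\int[rho]_x u x)%R%:E.
  move=> rho2; rewrite /Rintegral fineK//.
  exact: (integrable_fin_num measurableT
    (smooth_integrable u rho 0%R du lipu rho2)).
rewrite !uE// -EFinB lee_fin.
set S := ((_ + _) / 2)%R; apply/ler_addgt0Pr => e e0.
have [|gamma gmn /andP[wc cw]] := approx (e * 2 / l)%R.
  by rewrite divr_gt0// mulr_gt0.
apply: (le_trans (coupling_bound _ _ mu2 nu2 _ gmn _ _ bar du lipu l0)).
rewrite addrAC lerD//.
  rewrite (_ : _ + e = l / 2 * (w + e * 2 / l))%R; last by field; rewrite gt_eqF.
  by rewrite ler_pM2l ?divr_gt0// ltW.
by rewrite ler_pM2r ?invr_gt0 ?mulr_gt0// lerD2l lerN2 ler_pM2r// invr_gt0.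
Qed.

End distances.

Theorem corollary4p2 (R : realType) (d : nat) (hd : (1 <= d)%N)
    (mu nu : probability 'rV[R]_d R) (hmu : P2 mu) (hnu : P2 nu)
    (hbar : barycentre mu = barycentre nu) :
  Z2 mu nu <= sqrte ((var mu + var nu) / 2%:E) * W2 mu nu /\
  (Z2 mu nu = sqrte ((var mu + var nu) / 2%:E) * W2 mu nu <->
   (* a measure is a function on all sets, meaningful only on measurable ones *)
   forall A : set 'rV[R]_d, measurable A -> mu A = nu A).
Proof.
have [w w0 [W2w approx]] := W2_approx mu nu hmu hnu.
set S := ((fine (var mu) + fine (var nu)) / 2)%R.
have S0 : (0 <= S)%R.
  rewrite divr_ge0// addr_ge0// fine_ge0// integral_ge0// => x _;
    by rewrite lee_fin sqr_ge0.
have bound l := Z2_bound mu nu hmu hnu w l hbar^~ approx.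
have Zfin : Z2 mu nu \is a fin_num.
  by rewrite ge0_fin_numE ?Z2_ge0// (le_lt_trans (bound 1%R ltr01)) ?ltry.
have -> : sqrte ((var mu + var nu) / 2%:E) * W2 mu nu =
    (Num.sqrt S * Num.sqrt w)%R%:E.
  rewrite -(fineK (var_fin_num mu hmu)) -(fineK (var_fin_num nu hnu)).
  by rewrite W2w inver pnatr_eq0.
have Z0 : (0 <= fine (Z2 mu nu))%R by rewrite fine_ge0// Z2_ge0.
have [] := le_sqrtM_young R _ S w Z0 S0 w0.
  by move=> l l0; rewrite -lee_fin fineK//; exact: bound.
move=> le eq; rewrite -(fineK Zfin) lee_fin; split => //; split.
  move=> [/eq w_eq0]; apply: small_coupling_eq => e e0.
  have [gamma gmn /andP[_ ce]] := approx e e0; exists gamma => //.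
  by rewrite (cost_EFin _ _ hmu hnu _ gmn) lte_fin -[e]add0r -w_eq0.
move=> munu; rewrite Z2_eq0//; move: (W2_eq0 mu nu munu); rewrite W2w => -[->].
by rewrite mulr0.
Qed.
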